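(* Assume: (1) there is a modulus of continuity $\omega$ such that $|b(x,\alpha)-b(y,\alpha)|\le \omega(|x-y|)$ for all $x,y\in\overline\Omega$, $\alpha\in A$; (2) there are $\beta\in(1/2,1]$ and $B>0$ such that $|\sigma(x,\alpha)-\sigma(y,\alpha)|\le B|x-y|^\beta$ for all $x,y\in\overline\Omega$, $\alpha\in A$; (3) there exist $\delta,k>0$ and $\gamma<2\beta-1$ such that for every $\overline x\in\partial\Omega$ and every $\alpha\in A$ one has $\sigma^T(\overline x,\alpha)Dd(\overline x)=0$, and $$b(x,\alpha)\cdot Dd(x)+\operatorname{tr}\big(a(x,\alpha)D^2d(x)\big)\ge k\,d^\gamma(x)\qquad\text{for all }x\in\Omega_\delta,\ \alpha\in A;$$ (4) $F$ satisfies the Strong Minimum Principle in $\Omega$. If $v\in LSC(\Omega)$ is a viscosity supersolution of $F[v]=0$ in $\Omega$ satisfying $$\liminf_{x\to\partial\Omega}\frac{v(x)}{-\log d(x)}\ge 0,$$ then $v$ is constant.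
   Context: $\Omega\subset\mathbb R^n$ is a bounded connected open set with $C^2$ boundary. $d$ is the signed distance $d(x)=\operatorname{dist}(x,\mathbb R^n\setminus\Omega)-\operatorname{dist}(x,\overline\Omega)$, which is of class $C^2$ near $\partial\Omega$, and $\Omega_\delta=\{x\in\Omega: d(x)<\delta\}$; the $\delta$ in (3) is understood small enough that $d$ is $C^2$ on $\overline{\Omega_\delta}$. $A\subseteq\mathbb R^m$ is closed; $b:\overline\Omega\times A\to\mathbb R^n$ and $a:\overline\Omega\times A\to\mathbb R^{n\times n}$ are bounded and continuous; $a(x,\alpha)$ is symmetric and nonnegative definite, and $a=\sigma\sigma^T$ with $\sigma:\overline\Omega\times A\to\mathbb R^{n\times r}$, $r\ge1$. $|\cdot|$ is the Euclidean norm, also for matrices. The Hamilton-Jacobi-Bellman operator is $$F[u](x)=\sup_{\alpha\in A}\big(-b(x,\alpha)\cdot Du(x)-\operatorname{tr}(a(x,\alpha)D^2u(x))\big).$$ A modulus of continuity is a nonnegative function on $[0,\infty)$, continuous at $0$ with value $0$ at $0$. $USC(\Omega)$, $LSC(\Omega)$ are the sets of upper, respectively lower, semicontinuous functions on $\Omega$. An operator $G$ satisfies the Strong Maximum Principle in $\Omega$ if every viscosity subsolution $u\in USC(\Omega)$ of $G[u]=0$ in $\Omega$ for which there is $x_0\in\Omega$ with $u(x_0)=\max_\Omega u$ is constant. $F$ satisfies the Strong Minimum Principle in $\Omega$ if the operator $u\mapsto -F[-u]=\inf_{\alpha\in A}(-b(x,\alpha)\cdot Du-\operatorname{tr}(a(x,\alpha)D^2u))$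 satisfies the Strong Maximum Principle in $\Omega$. *)

(* Defs.v *)
From mathcomp Require Import all_boot all_order all_algebra.
From mathcomp Require Import all_classical all_reals all_analysis.

Set Implicit Arguments.
Unset Strict Implicit.
Unset Printing Implicit Defensive.

Import Order.TTheory GRing.Theory Num.Theory.
Import numFieldNormedType.Exports.

Local Open Scope classical_set_scope.
Local Open Scope ring_scope.

Section Euclidean.
Context {R : realType}.

(* The library's norm on matrices is the sup norm, hence this Euclidean
   (Frobenius) norm; both define the same topology and bounded sets. *)
Definition enorm p q (M : 'M[R]_(p, q)) : R :=
  Num.sqrt (\sum_i \sum_j M i j ^+ 2).

Definition dot n (x y : 'rV[R]_n) : R := \sum_i x 0 i * y 0 i.

Definition dist n (x : 'rV[R]_n) (S : set 'rV[R]_n) : R :=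
  inf [set enorm (x - y) | y in S].

End Euclidean.

Section Calculus.
Context {R : realType} {n : nat}.
Implicit Types (U : set 'rV[R]_n) (f : 'rV[R]_n -> R).

Definition partial (i : 'I_n) f (x : 'rV[R]_n) : R :=
  derive f x (delta_mx 0 i).

Definition grad f (x : 'rV[R]_n) : 'rV[R]_n := \row_i partial i f x.

Definition hess f (x : 'rV[R]_n) : 'M[R]_n :=
  \matrix_(i, j) partial i (partial j f) x.

(* Meant for open U. *)
Definition C2_on U f : Prop :=
  [/\ forall x, U x -> differentiable f x,
      forall x, U x -> forall i, differentiable (partial i f) x &
      forall x, U x -> forall i j,
        {for x, continuous (partial i (partial j f))}].

End Calculus.

Section Domain.
Context {R : realType} {n : nat}.
Variable Omega : set 'rV[R]_n.

Definition bdry : set 'rV[R]_n := closure Omega `\` interior Omega.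

(* Near each boundary point, Omega lies strictly above the graph of a C^2
   function g over the hyperplane orthogonal to a unit vector nu.  A function
   of the n - 1 coordinates orthogonal to nu is encoded as a function on R^n
   that is invariant under translations along nu. *)
Definition C2_boundary : Prop :=
  forall x0, bdry x0 ->
  exists (rho : R) (nu : 'rV[R]_n) (g : 'rV[R]_n -> R),
    [/\ 0 < rho, enorm nu = 1, C2_on setT g,
        forall y t, g (y + t *: nu) = g y &
        forall y, enorm (y - x0) < rho -> (Omega y <-> g y < dot y nu)].

Definition sdist (x : 'rV[R]_n) : R := dist x (~` Omega) - dist x (closure Omega).

Definition collar (delta : R) : set 'rV[R]_n :=
  [set x | Omega x /\ sdist x < delta].

(* The filter "x -> bdry Omega, x in Omega". *)
Definition to_bdry : set_system 'rV[R]_n :=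
  filter_from [set delta : R | 0 < delta] collar.

(* In the subspace topology of Omega points outside Omega are isolated, so the
   values of v outside Omega are irrelevant. *)
Definition lsc_on (v : 'rV[R]_n -> R) : Prop :=
  lower_semicontinuous ((fun x => (v x)%:E) : subspace Omega -> \bar R).

Definition usc_on (u : 'rV[R]_n -> R) : Prop := lsc_on (fun x => - u x).

Definition constant_on (u : 'rV[R]_n -> R) : Prop :=
  exists c : R, forall x, Omega x -> u x = c.

End Domain.

Section Viscosity.
Context {R : realType} {n : nat}.

(* An operator G sends a C^2 function phi and a point x to G[phi](x), which is
   meant to depend only on x, phi x, grad phi x and hess phi x. *)
Definition operator : Type := ('rV[R]_n -> R) -> 'rV[R]_n -> \bar R.

Implicit Types (Omega : set 'rV[R]_n) (G : operator) (u v : 'rV[R]_n -> R).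

Definition visc_subsol Omega G u : Prop :=
  forall (phi : 'rV[R]_n -> R) x, C2_on Omega phi -> Omega x ->
    phi x = u x -> (\forall y \near x, u y <= phi y) -> (G phi x <= 0)%E.

Definition visc_supersol Omega G v : Prop :=
  forall (phi : 'rV[R]_n -> R) x, C2_on Omega phi -> Omega x ->
    phi x = v x -> (\forall y \near x, phi y <= v y) -> (0 <= G phi x)%E.

Definition strong_max_principle Omega G : Prop :=
  forall u, usc_on Omega u -> visc_subsol Omega G u ->
    (exists2 x0, Omega x0 & forall x, Omega x -> u x <= u x0) ->
    constant_on Omega u.

Definition strong_min_principle Omega G : Prop :=
  strong_max_principle Omega (fun u x => - G (fun y => (- u y)%R) x)%E.

(* The supremum is taken in \bar R: it is finite for bounded coefficients and
   nonempty A. *)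
Definition HJB m (A : set 'rV[R]_m)
    (b : 'rV[R]_n -> 'rV[R]_m -> 'rV[R]_n)
    (a : 'rV[R]_n -> 'rV[R]_m -> 'M[R]_n) : operator :=
  fun u x => ereal_sup
    [set (- dot (b x alpha) (grad u x) - \tr (a x alpha *m hess u x))%:E
    | alpha in A].

End Viscosity.

Definition modulus_of_continuity {R : realType} (omega : R -> R) : Prop :=
  [/\ forall t, 0 <= t -> 0 <= omega t, omega 0 = 0 &
      omega t @[t --> 0^'+] --> 0].

(* Main.v *)
Require Import Defs.
From mathcomp Require Import all_boot all_order all_algebra.
From mathcomp Require Import all_classical all_reals all_analysis.
From mathcomp Require Import ring lra.

Import Order.TTheory GRing.Theory Num.Theory.
Import numFieldNormedType.Exports.

Local Open Scope classical_set_scope.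
Local Open Scope ring_scope.

(** Write d for the signed distance.  If y is a boundary point nearest to x then
    Dd(x) = Dd(y), so sigma^T(x) Dd(x) = (sigma(x) - sigma(y))^T Dd(x) and
    |sigma^T(x) Dd(x)|^2 <= B^2 d(x)^(2 beta).  Hence for W = h(d), with h
    convex, decreasing and h'' <= - 6 h' / d, every linear operator in F is
    positive on W near the boundary: the drift contributes - h' k d^gamma, which
    dominates h'' B^2 d^(2 beta) since gamma < 2 beta - 1.  Let m be the minimum
    of v on {d >= d0}.  If v < m somewhere in {d < d0}, then for a small eps > 0
    the function v + eps (W - h(d0)), which blows up at the boundary, has a
    minimum below m inside {d < d0}, and there - eps W + const touches v from
    below, contradicting the supersolution property.  So v attains its minimum
    over Omega and the strong minimum principle applies. *)

(** * Locality of derivatives and the chain rule to second order *)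

Lemma near_eq_differentiable (R : numFieldType) (V W : normedModType R)
    (f g : V -> W) (x : V) :
  {near x, f =1 g} -> differentiable f x -> differentiable g x.
Proof.
move=> fg /diff_locallyP[dfc dfo].
have fgx := nbhs_singleton fg.
(* An expansion of [g] with linear part ['d f x] suffices: [diff_unique] then identifies that linear
   part with ['d g x]. *)
suff E : g \o shift x = cst (g x) + 'd f x +o_ 0 id.
  by apply/diff_locallyP; rewrite (diff_unique dfc E).
apply/eqaddoP => e e0.
move/eqaddoP : dfo => /(_ e e0) dfo.
have fg0 : \forall y \near (0 : V), f (y + x) = g (y + x).
  by move: fg; rewrite (near_shift 0) /= subr0.
near=> y; rewrite /= -fgx.
have -> : (g \o shift x - (cst (f x) + 'd f x)) y =
          (f \o shift x - (cst (f x) + 'd f x)) y.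
  by congr (_ - _) => /=; apply/esym; near: y.
by near: y.
Unshelve. all: by end_near. Qed.

Section Composition.
Context {R : realType} {n : nat}.
Implicit Types (f : 'rV[R]_n -> R) (h : R -> R) (x : 'rV[R]_n) (U : set 'rV[R]_n).

Lemma differentiable_comp_is_derive f h x d :
  differentiable f x -> is_derive (f x) 1 h d -> differentiable (h \o f) x.
Proof.
by move=> df [dh _]; apply: differentiable_comp => //; exact/derivable1_diffP.
Qed.

Lemma partial_comp f h x d (i : 'I_n) :
  differentiable f x -> is_derive (f x) 1 h d ->
  partial i (h \o f) x = d * partial i f x.
Proof.
move=> df dh; have [dh1 dhE] := dh.
rewrite /partial !deriveE//; last exact: differentiable_comp_is_derive dh.
move/derivable1_diffP : dh1 => dh1.
by rewrite diff_comp//= diff1E// derive1E dhE mulrC.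
Qed.

(** The conclusion is again local, not only at [x], so that two applications reach the second
    partials. *)
Lemma near_eq_partial f g x (i : 'I_n) :
  {near x, f =1 g} -> {near x, partial i f =1 partial i g}.
Proof.
move/nbhs_interior; apply: filterS => y fg; exact: near_eq_derive.
Qed.

Lemma C2_on_eq U f g : open U -> (forall x, U x -> f x = g x) ->
  C2_on U f -> C2_on U g.
Proof.
move=> oU fg [C0 C1 C2].
have fgn x : U x -> {near x, f =1 g}.
  by move=> Ux; apply: filterS (open_nbhs_nbhs (conj oU Ux)) => y /fg.
split=> x Ux.
- exact: near_eq_differentiable (fgn _ Ux) (C0 _ Ux).
- move=> i; apply: near_eq_differentiable (C1 _ Ux i).
  exact/near_eq_partial/fgn.
- move=> i j; have E := near_eq_partial _ _ _ i (near_eq_partial _ _ _ j (fgn _ Ux)).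
  rewrite /prop_for /continuous_at -(nbhs_singleton E).
  apply: cvg_trans (C2 _ Ux i j).
  exact: near_eq_cvg E.
Qed.

Lemma C2_on_cst U (c : R) : C2_on U (cst c : 'rV[R]_n -> R).
Proof.
have P1 i : partial i (cst c : 'rV[R]_n -> R) = cst 0.
  by apply/funext => x; rewrite /partial derive_cst.
have P2 i : partial i (cst 0 : 'rV[R]_n -> R) = cst 0.
  by apply/funext => x; rewrite /partial derive_cst.
split=> x _; first exact: differentiable_cst.
  by move=> i; rewrite P1; exact: differentiable_cst.
by move=> i j; rewrite P1 P2; exact: cst_continuous.
Qed.

Section C2_composition.
Variables (U : set 'rV[R]_n) (I : set R) (f : 'rV[R]_n -> R) (h h1 h2 : R -> R).
Hypotheses (oU : open U) (fC2 : C2_on U f) (fI : forall x, U x -> I (f x)).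
Hypotheses (dh : forall t, I t -> is_derive t 1 h (h1 t))
           (dh1 : forall t, I t -> is_derive t 1 h1 (h2 t)).

(** Holding near [x] and not just at [x], the identity can be differentiated once more. *)
Lemma near_partial_comp x (i : 'I_n) : U x ->
  {near x, (h1 \o f) \* partial i f =1 partial i (h \o f)}.
Proof.
move=> Ux; have [C0 _ _] := fC2.
apply: filterS (open_nbhs_nbhs (conj oU Ux)) => y Uy /=.
by rewrite (partial_comp _ _ _ _ _ (C0 _ Uy) (dh _ (fI _ Uy))).
Qed.

Lemma near_partial2_comp x (i j : 'I_n) : U x ->
  {near x, ((h2 \o f) \* (partial i f \* partial j f)) \+
           ((h1 \o f) \* partial i (partial j f)) =1
           partial i (partial j (h \o f))}.
Proof.
move=> Ux; have [C0 C1 _] := fC2.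
apply: filterS (open_nbhs_nbhs (conj oU Ux)) => y Uy /=.
rewrite -(nbhs_singleton (near_eq_partial _ _ _ i (near_partial_comp y j Uy))).
have d1 : differentiable (h1 \o f) y.
  by apply: differentiable_comp_is_derive (C0 _ Uy) (dh1 _ (fI _ Uy)).
rewrite [RHS]deriveM; last 2 first.
  exact: diff_derivable.
  exact/diff_derivable/C1.
rewrite -/(partial i (partial j f) y) -/(partial i (h1 \o f) y).
rewrite (partial_comp _ _ _ _ _ (C0 _ Uy) (dh1 _ (fI _ Uy))).
by rewrite /GRing.scale /=; ring.
Qed.

Lemma grad_comp x : U x -> grad (h \o f) x = h1 (f x) *: grad f x.
Proof.
move=> Ux; apply/rowP => i; rewrite !mxE.
by rewrite -(nbhs_singleton (near_partial_comp x i Ux)).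
Qed.

Lemma hess_comp x : U x ->
  hess (h \o f) x =
  h2 (f x) *: ((grad f x)^T *m grad f x) + h1 (f x) *: hess f x.
Proof.
move=> Ux; apply/matrixP => i j; rewrite !mxE big_ord1 !mxE.
by rewrite -(nbhs_singleton (near_partial2_comp x i j Ux)).
Qed.

(** Derivatives of [h] are asked only at values of [f]: with [I] the positive half-line this admits
    the barrier, which blows up at 0. *)
Lemma C2_on_comp : (forall t, I t -> {for t, continuous h2}) ->
  C2_on U (h \o f).
Proof.
move=> ch2; have [C0 C1 C2] := fC2; split=> x Ux.
- exact: differentiable_comp_is_derive (C0 _ Ux) (dh _ (fI _ Ux)).
- move=> i; apply: near_eq_differentiable (near_partial_comp x i Ux) _.
  apply: differentiableM; last exact: C1.
  exact: differentiable_comp_is_derive (C0 _ Ux) (dh1 _ (fI _ Ux)).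
- move=> i j; have E := near_partial2_comp x i j Ux.
  rewrite /prop_for /continuous_at -(nbhs_singleton E).
  have cf : {for x, continuous f} by exact/differentiable_continuous/C0.
  have ch1 : {for f x, continuous h1}.
    apply: differentiable_continuous; apply/derivable1_diffP.
    by have [] := dh1 _ (fI _ Ux).
  have cfi k : {for x, continuous (partial k f)}.
    exact/differentiable_continuous/C1.
  apply: cvg_trans; first exact: near_eq_cvg E.
  apply: cvgD; apply: cvgM.
  + exact: (@continuous_comp _ _ _ f h2 x cf (ch2 _ (fI _ Ux))).
  + by apply: cvgM; exact: cfi.
  + exact: (@continuous_comp _ _ _ f h1 x cf ch1).
  + exact: C2.
Qed.

End C2_composition.
End Composition.

(** Away from 0 the function is locally 0 or a power. At 0 the difference quotient is
    [Num.max 0 h ^+ k.+1], which tends to 0 because its exponent is positive; the first power of the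
    positive part would fail here. *)
Lemma is_derive_max0X (R : realType) (k : nat) (t : R) :
  is_derive t 1 (fun s : R => Num.max 0 s ^+ k.+2)
    (k.+2%:R * Num.max 0 t ^+ k.+1).
Proof.
have [t0|t0|->] := ltgtP t 0.
- apply: (@near_eq_is_derive R R R (cst 0)).
    near=> s; rewrite max_l ?expr0n//.
    by apply/ltW; near: s; exact: lt_nbhsl.
  by rewrite expr0n/= mulr0; exact: is_derive_cst.
- apply: (@near_eq_is_derive R R R (fun s : R => s ^+ k.+2)).
    near=> s; rewrite max_r//.
    by apply/ltW; near: s; exact: lt_nbhsr.
  apply: DeriveDef; first exact: exprn_derivable.
  by rewrite exp_derive /GRing.scale /= mulr1 mulr_natl.
- rewrite expr0n /= mulr0.
  have H : h^-1 *: (Num.max 0 (h *: (1 : R) + 0) ^+ k.+2 - Num.max 0 (0 : R) ^+ k.+2)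
      @[h --> 0^'] --> (0 : R).
    apply: (@cvg_trans _ (Num.max 0 h ^+ k.+1 @[h --> (0 : R)^'])).
      apply: near_eq_cvg; near=> h.
      have h0 : h != 0 by near: h; exact: nbhs_dnbhs_neq.
      rewrite maxxx expr0n subr0 addr0 /GRing.scale /= mulr1.
      case: (leP 0 h) => _; last by rewrite !expr0n /= mulr0.
      by rewrite [in RHS]exprS mulrA mulVf// mul1r.
    apply: (@cvg_within_filter _ _ _ (nbhs (0 : R))).
    have -> : (0 : R) = Num.max 0 (0 : R) ^+ k.+1 by rewrite maxxx expr0n.
    have : {for (0 : R), continuous (fun h : R => Num.max 0 h ^+ k.+1)}.
      apply: (@continuous_comp _ _ _ (fun h : R => Num.max 0 h) (fun h : R => h ^+ k.+1)).
        by apply: continuous_max; [exact: cst_continuous|exact: id].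
      exact: exprn_continuous.
    by rewrite /prop_for /continuous_at /= maxxx expr0n.
  by apply: DeriveDef; [apply/cvg_ex; exists 0|exact: cvg_lim H].
Unshelve. all: by end_near. Qed.

(** * The Cauchy-Schwarz inequality and the Euclidean norm *)

Lemma le_sum_sqrM {R : realType} {I : finType} (F G : I -> R) :
  (\sum_i F i * G i) ^+ 2 <= (\sum_i F i ^+ 2) * (\sum_i G i ^+ 2).
Proof.
set S := \sum_i F i * G i; set P := \sum_i F i ^+ 2; set Q := \sum_i G i ^+ 2.
have Q0 : 0 <= Q by apply: sumr_ge0 => i _; exact: sqr_ge0.
have [Qz|Qn] := eqVneq Q 0.
  have Gz i : G i = 0.
    apply/eqP; rewrite -sqrf_eq0; apply/eqP.
    by apply: (psumr_eq0P _ Qz) => // j _; exact: sqr_ge0.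
  rewrite Qz mulr0 /S big1 ?expr0n// => i _.
  by rewrite Gz mulr0.
have Qp : 0 < Q by rewrite lt_def Qn.
have : 0 <= \sum_i (Q * F i - S * G i) ^+ 2.
  by apply: sumr_ge0 => i _; exact: sqr_ge0.
(* The sum of these squares is [Q] times the defect of the inequality, and [Q] is positive by
   now. *)
have -> : \sum_i (Q * F i - S * G i) ^+ 2 = Q * (P * Q - S ^+ 2).
  under eq_bigr => i _ do rewrite sqrrB.
  rewrite big_split sumrB /=.
  have -> : \sum_i (Q * F i) ^+ 2 = Q ^+ 2 * P.
    by rewrite mulr_sumr; apply: eq_bigr => i _; rewrite exprMn.
  have -> : \sum_i Q * F i * (S * G i) *+ 2 = (Q * S * S) *+ 2.
    transitivity (\sum_i (Q * S *+ 2) * (F i * G i)).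
      by apply: eq_bigr => i _; ring.
    by rewrite -mulr_sumr -/S; ring.
  have -> : \sum_i (S * G i) ^+ 2 = S ^+ 2 * Q.
    by rewrite mulr_sumr; apply: eq_bigr => i _; rewrite exprMn.
  by ring.
by rewrite pmulr_rge0// subr_ge0.
Qed.

Section EuclideanNorm.
Context {R : realType}.

Lemma enorm_ge0 p q (M : 'M[R]_(p, q)) : 0 <= enorm M.
Proof. exact: sqrtr_ge0. Qed.

Lemma enorm_sqr p q (M : 'M[R]_(p, q)) :
  enorm M ^+ 2 = \sum_i \sum_j M i j ^+ 2.
Proof.
by rewrite sqr_sqrtr//; do 2 (apply: sumr_ge0 => ? _); exact: sqr_ge0.
Qed.

Lemma enorm_mulmx_sqr p q s (M : 'M[R]_(p, q)) (N : 'M[R]_(q, s)) :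
  enorm (M *m N) ^+ 2 <= enorm M ^+ 2 * enorm N ^+ 2.
Proof.
rewrite !enorm_sqr [X in _ * X]exchange_big /= mulr_suml.
apply: ler_sum => i _; rewrite mulr_sumr; apply: ler_sum => j _.
by rewrite !mxE; exact: le_sum_sqrM.
Qed.

Lemma enorm_tr p q (M : 'M[R]_(p, q)) : enorm M^T = enorm M.
Proof.
congr Num.sqrt; rewrite exchange_big /=.
by apply: eq_bigr => i _; apply: eq_bigr => j _; rewrite mxE.
Qed.

Context {n : nat}.
Implicit Types x y : 'rV[R]_n.

Lemma enorm_rV_sqr x : enorm x ^+ 2 = dot x x.
Proof. by rewrite enorm_sqr big_ord1; apply: eq_bigr => i _; rewrite expr2. Qed.

Lemma dotDl x y z : dot (x + y) z = dot x z + dot y z.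
Proof. by rewrite /dot -big_split; apply: eq_bigr => i _; rewrite mxE mulrDl. Qed.

Lemma dotZl (c : R) x z : dot (c *: x) z = c * dot x z.
Proof. by rewrite /dot mulr_sumr; apply: eq_bigr => i _; rewrite mxE mulrA. Qed.

Lemma dotC x y : dot x y = dot y x.
Proof. by apply: eq_bigr => i _; rewrite mulrC. Qed.

Lemma dotDr x y z : dot z (x + y) = dot z x + dot z y.
Proof. by rewrite dotC dotDl !(dotC z). Qed.

Lemma dotZr (c : R) x z : dot z (c *: x) = c * dot z x.
Proof. by rewrite dotC dotZl (dotC z). Qed.

Lemma dot_le x y : dot x y <= enorm x * enorm y.
Proof.
have [?|d0] := leP (dot x y) 0.
  by apply: (@le_trans _ _ 0) => //; apply: mulr_ge0; exact: enorm_ge0.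
rewrite -(@ler_pXn2r _ 2)// ?nnegrE ?(ltW d0) ?mulr_ge0 ?enorm_ge0//.
by rewrite exprMn !enorm_sqr !big_ord1; exact: le_sum_sqrM.
Qed.

Lemma enormD x y : enorm (x + y) <= enorm x + enorm y.
Proof.
rewrite -(@ler_pXn2r _ 2)// ?nnegrE ?addr_ge0 ?enorm_ge0//.
rewrite enorm_rV_sqr sqrrD !enorm_rV_sqr dotDl !dotDr (dotC y x).
by have := dot_le x y; lra.
Qed.

Lemma enormZ (c : R) x : enorm (c *: x) = `|c| * enorm x.
Proof.
apply/eqP; rewrite -(@eqrXn2 _ 2)// ?mulr_ge0 ?enorm_ge0//.
by rewrite exprMn real_normK ?num_real// !enorm_rV_sqr dotZl dotZr; apply/eqP; ring.
Qed.

Lemma enormN x : enorm (- x) = enorm x.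
Proof. by rewrite -scaleN1r enormZ normrN1 mul1r. Qed.

Lemma enormC x y : enorm (x - y) = enorm (y - x).
Proof. by rewrite -enormN opprB. Qed.

Lemma enorm0 : enorm (0 : 'rV[R]_n) = 0.
Proof. by rewrite -(scale0r (0 : 'rV[R]_n)) enormZ normr0 mul0r. Qed.

Lemma enorm_eq0 x : enorm x = 0 -> x = 0.
Proof.
move=> x0; apply/rowP => i; rewrite mxE; apply/eqP; rewrite -sqrf_eq0; apply/eqP.
have : \sum_i x 0 i ^+ 2 = 0.
  by have := enorm_sqr _ _ x; rewrite x0 expr0n big_ord1 => /esym.
by move=> /psumr_eq0P; apply=> // j _; exact: sqr_ge0.
Qed.

(** Boundedness is measured in the sup norm, so this makes Euclidean balls bounded sets. *)
Lemma norm_le_enorm x : `|x| <= enorm x.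
Proof.
rewrite [leLHS]/Num.norm /= mx_normrE; apply/bigmax_leP; split; first exact: enorm_ge0.
move=> [i j] _ /=; rewrite -(@ler_pXn2r _ 2)// ?nnegrE ?enorm_ge0//.
rewrite real_normK ?num_real// enorm_sqr big_ord1 (ord1 i) (bigD1 j)//= lerDl.
by apply: sumr_ge0 => ? _; exact: sqr_ge0.
Qed.

Lemma enorm_continuous : continuous (@enorm R 1 n).
Proof.
have -> : @enorm R 1 n = Num.sqrt \o (fun x => \sum_j x 0 j ^+ 2).
  by apply/funext => x; rewrite /enorm big_ord1.
move=> x; apply: continuous_comp; last exact: sqrt_continuous.
apply: cvg_big; [exact: add_continuous|exact: nbhs_filter|move=> j _].
apply: (@continuous_comp _ _ _ (fun y : 'rV[R]_n => y 0 j) (fun t : R => t ^+ 2)).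
  exact: coord_continuous.
exact: exprn_continuous.
Qed.

Lemma enorm_sub_continuous x : continuous (fun y => enorm (x - y)).
Proof.
move=> y; apply: (@continuous_comp _ _ _ (fun y => x - y) (@enorm R 1 n)).
  by apply: continuousB; [exact: cst_continuous|exact: id].
exact: enorm_continuous.
Qed.

End EuclideanNorm.

(** * Distance to a set: Lipschitz bound and nearest points *)

Section Distance.
Context {R : realType} {n : nat}.
Implicit Types (x y : 'rV[R]_n) (S : set 'rV[R]_n).

Lemma dist_le x y S : S y -> dist x S <= enorm (x - y).
Proof.
move=> Sy; apply: ge_inf; last by exists y.
by exists 0 => _ [z _ <-]; exact: enorm_ge0.
Qed.

Lemma le_dist x S (c : R) : S !=set0 ->
  (forall y, S y -> c <= enorm (x - y)) -> c <= dist x S.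
Proof.
move=> [y Sy] cS; apply: lb_le_inf; first by exists (enorm (x - y)), y.
by move=> _ [z Sz <-]; exact: cS.
Qed.

Lemma dist_ge0 x S : 0 <= dist x S.
Proof.
(* The infimum of the empty set is 0 by convention. *)
have [->|/set0P S0] := eqVneq S set0; first by rewrite /dist image_set0 inf0.
by apply: le_dist => // y _; exact: enorm_ge0.
Qed.

Lemma dist_self x S : S x -> dist x S = 0.
Proof.
move=> Sx; apply/eqP; rewrite eq_le dist_ge0 andbT.
by apply: le_trans (dist_le x x S Sx) _; rewrite subrr enorm0.
Qed.

Lemma dist_lip x y S : dist x S <= dist y S + enorm (x - y).
Proof.
have [->|/set0P S0] := eqVneq S set0.
  by rewrite /dist !image_set0 inf0 add0r enorm_ge0.
rewrite -lerBlDr; apply: le_dist => // z Sz.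
rewrite lerBlDr; apply: le_trans (dist_le _ _ _ Sz) _.
by rewrite -(subrKA y) addrC; exact: enormD.
Qed.

(** Only the points of [S] no farther from [x] than some [s] in [S] compete. They form a closed
    bounded set, hence a compact one, on which the continuous Euclidean distance to [x] has a
    minimum. *)
Lemma dist_attained x S : S !=set0 -> closed S ->
  exists2 y, S y & enorm (x - y) = dist x S.
Proof.
move=> [s Ss] cS.
have ce := @enorm_sub_continuous R n x.
pose K := S `&` [set y | enorm (x - y) <= enorm (x - s)].
have Kc : compact K.
  apply: bounded_closed_compact.
    exists (`|x| + enorm (x - s)); split; first exact: num_real.
    move=> M ltM y [_ /= ley]; apply/ltW/(le_lt_trans _ ltM).
    have -> : y = x - (x - y) by rewrite subKr.
    rewrite (le_trans (ler_normB _ _))// lerD2l (le_trans _ ley)//.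
    exact: norm_le_enorm.
  apply: closedI => //.
  apply: (@closed_comp _ _ (fun y => enorm (x - y)) [set t | t <= enorm (x - s)]).
    by move=> y _; exact: ce.
  exact: closed_le.
have [y yK ymin] : exists2 c, c \in K &
    forall t, t \in K -> enorm (x - c) <= enorm (x - t).
  apply: EVT_min_rV => //; first by exists s; split => //=.
  exact: continuous_subspaceT.
move: yK; rewrite inE => -[Sy ys]; exists y => //.
apply/eqP; rewrite eq_le dist_le// andbT; apply: le_dist; first by exists s.
move=> z Sz; have [lez|ltz] := leP (enorm (x - z)) (enorm (x - s)).
  by apply: ymin; rewrite inE.
exact: le_trans ys (ltW ltz).
Qed.

Lemma lip_continuous (f : 'rV[R]_n -> R) (c : R) : 0 < c ->
  (forall x y, f x <= f y + c * enorm (x - y)) -> continuous f.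
Proof.
move=> c0 fl x; have FF := nbhs_filter x; apply/cvgrPdist_le => e e0.
have cy : (fun y => enorm (x - y)) y @[y --> x] --> (0 : R).
  rewrite -(@enorm0 R n) -(subrr x); exact: enorm_sub_continuous.
move/cvgrPdist_le : cy => /(_ (e / c)) /(_ (divr_gt0 e0 c0)) cy.
near=> y.
have ce : c * enorm (x - y) <= e.
  rewrite mulrC -ler_pdivlMr//.
  have : `|0 - enorm (x - y)| <= e / c by near: y.
  by rewrite sub0r normrN ger0_norm ?enorm_ge0.
rewrite ler_norml; apply/andP; split.
  by have := fl y x; rewrite enormC; lra.
by have := fl x y; lra.
Unshelve. all: by end_near. Qed.

Lemma sdist_continuous (Omega : set 'rV[R]_n) : continuous (sdist Omega).
Proof.
(* The constant 2 is the sum of the Lipschitz constants of the two distances. *)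
apply: (lip_continuous _ 2 (ltr0Sn _ _)) => x y.
rewrite /sdist; have := dist_lip x y (~` Omega).
by have := dist_lip y x (closure Omega); rewrite enormC; lra.
Qed.

End Distance.

(** * Gradients recovered from one-sided directional bounds *)

Section DirectionalDerivative.
Context {R : realType} {n : nat}.
Implicit Types (f : 'rV[R]_n -> R) (z v e : 'rV[R]_n).

Lemma cvg_line z v : z + t *: v @[t --> 0^'+] --> z.
Proof.
apply: cvg_at_right_filter.
rewrite -[X in _ --> X]addr0 -(scale0r v).
by apply: cvgD; [exact: cvg_cst|apply: cvgZr_tmp; exact: cvg_id].
Qed.

Lemma derive_dot_grad f z v : differentiable f z -> 'D_v f z = dot (grad f z) v.
Proof.
move=> df; rewrite deriveE// [v in LHS]row_sum_delta linear_sum.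
by apply: eq_bigr => i _; rewrite linearZ /= mxE /partial deriveE// mulrC.
Qed.

(** For a differentiable function the directional derivative is already the limit of the difference
    quotients from the right. *)
Lemma dot_grad_le f z v (c : R) : differentiable f z ->
  (\forall h \near 0^'+, f (h *: v + z) <= f z + h * c) ->
  dot (grad f z) v <= c.
Proof.
move=> df fc; rewrite -derive_dot_grad// /derive.
have cv := @diff_derivable _ _ _ _ _ v df.
rewrite cvg_at_rightE//; apply: limr_le.
  apply: cvgP; apply: cvg_trans cv; apply: cvg_app.
  by apply: within_subset => //= t /gt_eqF ->.
near=> h; have h0 : 0 < h by near: h; exact: nbhs_right_gt.
rewrite /GRing.scale /= mulrC ler_pdivrMr// mulrC lerBlDl.
by near: h.
Unshelve. all: by end_near. Qed.

(** Let [p] be the gradient. The decrease along [- e] gives [1 <= dot p e]; the Lipschitz bound in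
    the direction [p] itself gives [|p|^2 <= |p|], so [|p| <= 1]. Hence
    [|p - e|^2 = |p|^2 - 2 p.e + 1 <= 0]. *)
Lemma grad_eq_unit f z e : differentiable f z -> enorm e = 1 ->
  (\forall y \near z, f y <= f z + enorm (y - z)) ->
  (\forall h \near 0^'+, f (h *: - e + z) <= f z - h) ->
  grad f z = e.
Proof.
move=> df e1 flip fe.
have ge1 : 1 <= dot (grad f z) e.
  rewrite -[leLHS]opprK lerNl -mulN1r -dotZr scaleN1r.
  by apply: dot_grad_le => //; apply: filterS fe => h; rewrite mulrN1.
set p := grad f z in ge1 *.
have p1 : enorm p ^+ 2 <= enorm p.
  rewrite enorm_rV_sqr; apply: dot_grad_le => //.
  have H := cvg_line z p _ flip; near=> h.
  have h0 : 0 < h by near: h; exact: nbhs_right_gt.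
  rewrite addrC.
  have : f (z + h *: p) <= f z + enorm (z + h *: p - z) by near: h.
  by rewrite [X in enorm X]addrAC subrr add0r enormZ gtr0_norm.
have p1' : enorm p <= 1 by have := enorm_ge0 _ _ p; nra.
apply/eqP; rewrite -subr_eq0; apply/eqP/enorm_eq0/eqP.
rewrite -sqrf_eq0 eq_le sqr_ge0 andbT.
rewrite enorm_rV_sqr -scaleN1r !(dotDl, dotDr, dotZl, dotZr).
rewrite -!enorm_rV_sqr e1 (dotC e p); have := enorm_ge0 _ _ p; nra.
Unshelve. all: by end_near. Qed.

End DirectionalDerivative.

(** * The signed distance and its gradient near the boundary *)

Section SignedDistance.
Context {R : realType} {n : nat}.
Variable Omega : set 'rV[R]_n.
Implicit Types x y z e : 'rV[R]_n.

(** The constant vector with entries [|M| + 2] exceeds the bound in sup norm. Positive dimension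
    provides an entry: in dimension 0 the whole space is bounded. *)
Lemma bounded_setC_nonempty : (0 < n)%N -> bounded_set Omega -> ~` Omega !=set0.
Proof.
move=> n0 [M [_ OM]]; apply: contrapT => /set0P/negP/negPn/eqP OT.
have := OM (`|M| + 1); rewrite (le_lt_trans (ler_norm M)) ?ltrDl// => /(_ isT).
have Oc : Omega (const_mx (`|M| + 2)).
  by apply: contrapT => nO; have : (~` Omega) (const_mx (`|M| + 2)) by []; rewrite OT.
move=> /(_ _ Oc) /=; apply/negP; rewrite -ltNge.
have : `|M| + 2 <= `|const_mx (`|M| + 2) : 'rV[R]_n|.
  rewrite [leRHS]/Num.norm /= mx_normrE.
  apply: le_trans (le_bigmax _ _ (ord0, Ordinal n0)) => /=.
  by rewrite mxE ler_norm.
by apply: lt_le_trans; rewrite ltrD2l ltr1n.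
Qed.

Lemma sdist_in x : Omega x -> sdist Omega x = dist x (~` Omega).
Proof.
by move=> Ox; rewrite /sdist [X in _ - X]dist_self ?subr0//; exact: subset_closure.
Qed.

Lemma sdist_gt0_in x : 0 < sdist Omega x -> Omega x.
Proof.
move=> d0; apply: contrapT => nOx; move: d0; rewrite /sdist dist_self//.
by rewrite sub0r oppr_gt0 ltNge dist_ge0.
Qed.

Hypotheses (Omega_open : open Omega) (OmegaC0 : ~` Omega !=set0).

Lemma sdist_gt0 x : Omega x -> 0 < sdist Omega x.
Proof.
move=> Ox; rewrite sdist_in// lt_def dist_ge0 andbT; apply/negP => /eqP d0.
have [y nOy] := dist_attained x _ OmegaC0 (open_closedC Omega_open).
by rewrite d0 => /enorm_eq0/eqP; rewrite subr_eq0 => /eqP xy; apply: nOy; rewrite -xy.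
Qed.

Lemma collar_open (r : R) : open (collar Omega r).
Proof.
apply: openI => //; apply: (@open_comp _ _ (sdist Omega) [set t | t < r]); last exact: open_lt.
by move=> x _; exact: sdist_continuous.
Qed.

(** Take [y] nearest to [x] in the complement and [e] the unit vector from [y] to [x]. At
    [y + t *: e] the distance is at most [t], since [y] lies outside [Omega], and at least [t],
    since it drops by at most [d - t] on the way from [x]. So the segment enters [Omega] immediately
    after [y], which puts [y] in the closure. *)
Lemma sdist_nearest x : Omega x -> exists y e,
  [/\ bdry Omega y, enorm e = 1, enorm (x - y) = sdist Omega x,
      x = y + sdist Omega x *: e &
      forall t, 0 <= t <= sdist Omega x -> dist (y + t *: e) (~` Omega) = t].
Proof.
move=> Ox; have d0 := sdist_gt0 _ Ox.
have [y nOy yx] := dist_attained x _ OmegaC0 (open_closedC Omega_open).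
rewrite -sdist_in// in yx; set d := sdist Omega x in d0 yx *.
pose e := d^-1 *: (x - y); exists y, e.
have e1 : enorm e = 1 by rewrite enormZ yx gtr0_norm ?invr_gt0// mulVf// gt_eqF.
have xE : x = y + d *: e by rewrite scalerA divff ?gt_eqF// scale1r subrKC.
have tE t : 0 <= t <= d -> dist (y + t *: e) (~` Omega) = t.
  move=> /andP[t0 td]; apply/eqP; rewrite eq_le; apply/andP; split.
    by apply: le_trans (dist_le _ _ _ nOy) _; rewrite addrC addKr enormZ e1 mulr1 ger0_norm.
  have := dist_lip x (y + t *: e) (~` Omega).
  rewrite -sdist_in// -/d {1}xE opprD addrACA subrr add0r -scalerBl enormZ e1.
  by rewrite mulr1 ger0_norm ?subr_ge0//; lra.
split => //; split; last by move=> /interior_subset.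
move=> A; rewrite /= => Ay.
have H := cvg_line y e _ Ay.
have : \forall t \near 0^'+, (Omega `&` A) (y + t *: e).
  near=> t; split; last by near: t.
  have t0 : 0 < t by near: t; exact: nbhs_right_gt.
  have td : t <= d by near: t; exact: nbhs_right_le.
  apply: contrapT => nO; have := tE t; rewrite (ltW t0) td dist_self// => /(_ isT) t0'.
  by rewrite -t0' ltxx in t0.
by move/filter_ex => [t ?]; exists (y + t *: e).
Unshelve. all: by end_near. Qed.

(* On the segment from x to its nearest boundary point y the gradient of the
   distance is the constant unit vector along the segment, since there a
   1-Lipschitz function grows at unit speed; by continuity this persists at y. *)
Lemma grad_sdist_nearest (delta : R) (U : set 'rV[R]_n) x :
  closure (collar Omega delta) `<=` U -> C2_on U (sdist Omega) ->
  collar Omega delta x ->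
  exists y, [/\ bdry Omega y, enorm (x - y) = sdist Omega x,
    grad (sdist Omega) y = grad (sdist Omega) x & enorm (grad (sdist Omega) x) = 1].
Proof.
move=> cU [C0 C1 _] [Ox xd].
have [y [e [yb e1 xy xE tE]]] := sdist_nearest _ Ox.
have d0 := sdist_gt0 _ Ox; set d := sdist Omega x in d0 xy xE tE xd *.
have tO t : 0 < t <= d -> Omega (y + t *: e).
  move=> /andP[t0 td]; apply: contrapT => nO.
  have := tE t; rewrite (ltW t0) td dist_self// => /(_ isT) t0'.
  by rewrite -t0' ltxx in t0.
have tS t : 0 < t <= d -> sdist Omega (y + t *: e) = t.
  move=> ht; rewrite sdist_in; last exact: tO.
  by apply: tE; case/andP: ht => /ltW -> ->.
have tC t : 0 < t <= d -> collar Omega delta (y + t *: e).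
  move=> ht; split; first exact: tO.
  by rewrite tS//; case/andP: ht => _ td; exact: le_lt_trans td xd.
have gE t : 0 < t <= d -> grad (sdist Omega) (y + t *: e) = e.
  move=> ht; have /andP[t0 td] := ht; apply: grad_eq_unit => //.
  - exact/C0/cU/subset_closure/tC.
  - apply: filterS (open_nbhs_nbhs (conj Omega_open (tO _ ht))) => z Oz.
    by rewrite !sdist_in//; [exact: dist_lip|exact: tO].
  - near=> h.
    have h0 : 0 < h by near: h; exact: nbhs_right_gt.
    have ht' : h < t by near: h; exact: nbhs_right_lt.
    rewrite scalerN addrCA -scaleNr -scalerDl [- h + t]addrC !tS ?ht//.
    by apply/andP; split; lra.
exists y; split => //; last first.
  by rewrite [in LHS]xE gE// d0 lexx.
rewrite [in RHS]xE gE ?d0 ?lexx//.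
apply/rowP => i; rewrite mxE.
(* The point [y] is only a limit of points of the collar; this is where [U] must contain the
   closure. *)
have yU : U y.
  apply: cU => A Ay.
  have H := cvg_line y e _ Ay.
  have : \forall t \near 0^'+, (collar Omega delta `&` A) (y + t *: e).
    near=> t; split; last by near: t.
    apply: tC; apply/andP; split; near: t; [exact: nbhs_right_gt|exact: nbhs_right_le].
  by move/filter_ex => [t ?]; exists (y + t *: e).
have ci := differentiable_continuous (C1 _ yU i).
have H : partial i (sdist Omega) (y + t *: e) @[t --> 0^'+] --> partial i (sdist Omega) y.
  apply: (@cvg_comp _ _ _ (fun t : R => y + t *: e) (partial i (sdist Omega))); last exact: ci.
  exact: cvg_line.
rewrite -(cvg_lim _ H)//; apply: cvg_lim => //.
apply: cvg_near_cst; near=> t.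
have : grad (sdist Omega) (y + t *: e) = e.
  by apply: gE; apply/andP; split; near: t; [exact: nbhs_right_gt|exact: nbhs_right_le].
by move=> /rowP/(_ i); rewrite mxE.
Unshelve. all: by end_near. Qed.

End SignedDistance.

(** * The one-variable barrier and its differential inequality *)

Section Barrier.
Context {R : realType}.
Implicit Types s t : R.

(* A cube makes the barrier C^2 across t = s, where it becomes constant; its
   composition with the distance is thus C^2 on all of Omega although the
   distance is only C^2 near the boundary. *)
Definition barrier s t : R := Num.max 0 (s / t - 1) ^+ 3.

Definition barrier1 s t : R := - (3 * s * (Num.max 0 (s / t - 1) ^+ 2 * t^-1 ^+ 2)).

Definition barrier2 s t : R :=
  6 * s * (s * Num.max 0 (s / t - 1) * t^-1 ^+ 4 +
           Num.max 0 (s / t - 1) ^+ 2 * t^-1 ^+ 3).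

Lemma is_derive_inv t : 0 < t -> is_derive t 1 (fun x : R => x^-1) (- t^-1 ^+ 2).
Proof.
move=> t0; have := @is_deriveV R id t 1 1 (lt0r_neq0 t0) (is_derive_id _ _).
by rewrite /GRing.scale /= mulr1 exprVn.
Qed.

Lemma is_derive_barrier_arg s t : 0 < t ->
  is_derive t 1 (fun x : R => s / x - 1) (- (s * t^-1 ^+ 2)).
Proof.
move=> t0; have di := is_derive_inv _ t0.
apply: (@is_derive_eq _ _ _ (s \*: (fun x : R => x^-1) - cst 1)).
by rewrite subr0 /GRing.scale /= mulrN.
Qed.

Lemma is_derive_barrier s t : 0 < t -> is_derive t 1 (barrier s) (barrier1 s t).
Proof.
move=> t0; have du := is_derive_barrier_arg s _ t0.
have dm := is_derive1_comp (g := fun x => s / x - 1)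
  (is_derive_max0X R 1 (s / t - 1)) du.
apply: (is_derive_eq (f := barrier s) dm).
by rewrite /barrier1; ring.
Qed.

Lemma is_derive_barrier1 s t : 0 < t -> is_derive t 1 (barrier1 s) (barrier2 s t).
Proof.
move=> t0; have du := is_derive_barrier_arg s _ t0; have di := is_derive_inv _ t0.
have dm := is_derive1_comp (g := fun x => s / x - 1)
  (is_derive_max0X R 0 (s / t - 1)) du.
have di2 : is_derive t 1 (fun x : R => x^-1 ^+ 2) (2 * t^-1 * (- t^-1 ^+ 2)).
  apply: (@is_derive_eq _ _ _ ((fun x : R => x^-1) ^+ 2)).
  by rewrite /GRing.scale /= expr1.
apply: (@is_derive_eq _ _ _ (- ((3 * s) \*:
  (((fun x => Num.max 0 x ^+ 2) \o (fun x : R => s / x - 1)) *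
   (fun x : R => x^-1 ^+ 2))))).
by rewrite /barrier2 /GRing.scale /=; ring.
Qed.

Lemma barrier2_continuous s t : 0 < t -> {for t, continuous (barrier2 s)}.
Proof.
move=> t0.
have ci : {for t, continuous (fun x : R => x^-1)}.
  by apply: inv_continuous; rewrite gt_eqF.
have cm : {for t, continuous (fun x : R => Num.max 0 (s / x - 1))}.
  apply: continuous_max; first exact: cst_continuous.
  apply: continuousB; last exact: cst_continuous.
  by apply: continuousM => //; exact: cst_continuous.
have cX (f : R -> R) k : {for t, continuous f} -> {for t, continuous (fun x => f x ^+ k)}.
  by move=> cf; apply: (@continuous_comp _ _ _ f (fun x : R => x ^+ k)) => //; exact: exprn_continuous.
apply: continuousM; first exact: cst_continuous.
apply: continuousD; apply: continuousM; try exact: cX.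
by apply: continuousM => //; exact: cst_continuous.
Qed.

Lemma barrier_eq0 s t : 0 < t -> s <= t -> barrier s t = 0.
Proof.
move=> t0 st; rewrite /barrier max_l ?expr0n//.
by rewrite subr_le0 ler_pdivrMr// mul1r.
Qed.

Lemma barrier_nincr s t1 t2 : 0 < s -> 0 < t1 -> t1 <= t2 -> barrier s t2 <= barrier s t1.
Proof.
move=> s0 t10 t12; have t20 := lt_le_trans t10 t12.
have m0 (x : R) : 0 <= Num.max 0 x by rewrite le_max lexx.
apply: lerXn2r; rewrite ?nnegrE//; rewrite ge_max m0 /= le_max; apply/orP; right.
by rewrite lerB// ler_pM2l// lef_pV2.
Qed.

(** With [u = s / t >= 2], one has [(u - 1)^3 >= u - 1 >= u / 2]. The resulting growth of order
    [1 / t] outweighs the logarithm in the growth condition on [v]. *)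
Lemma barrier_ge s t : 0 < t -> t <= s / 2 -> s / (2 * t) <= barrier s t.
Proof.
move=> t0 ts; have u1 : 2 <= s / t by rewrite ler_pdivlMr//; lra.
have -> : s / (2 * t) = (s / t) / 2 by rewrite invfM mulrA mulrAC.
rewrite /barrier max_r; last lra.
set u := s / t in u1 *.
apply: (@le_trans _ _ (u - 1)); first lra.
by apply: ler_eXnr => //; lra.
Qed.

Lemma barrier1_lt0 s t : 0 < t -> t <= s / 2 -> barrier1 s t < 0.
Proof.
move=> t0 ts; have u1 : 2 <= s / t by rewrite ler_pdivlMr//; lra.
have s0 : 0 < s by lra.
rewrite /barrier1 max_r; last lra.
have u0 : 0 < s / t - 1 by lra.
by rewrite oppr_lt0; do !apply: mulr_gt0 => //; rewrite invr_gt0.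
Qed.

(** After removal of the common factor [6 s / t^3] the claim reads
    [u (u - 1) + (u - 1)^2 <= 3 (u - 1)^2] for [u = s / t], that is [u <= 2 (u - 1)]: hence the
    range [t <= s / 2]. *)
Lemma barrier2_le s t : 0 < t -> t <= s / 2 -> barrier2 s t <= - 6 / t * barrier1 s t.
Proof.
move=> t0 ts; have u1 : 2 <= s / t by rewrite ler_pdivlMr//; lra.
have s0 : 0 < s by lra.
rewrite /barrier1 /barrier2 max_r; last lra.
set u := s / t in u1 *; have -> : s * (u - 1) * t^-1 ^+ 4 = u * (u - 1) * t^-1 ^+ 3.
  by rewrite /u; field; rewrite gt_eqF.
have -> : - 6 / t * - (3 * s * ((u - 1) ^+ 2 * t^-1 ^+ 2)) =
   6 * s * (3 * (u - 1) ^+ 2 * t^-1 ^+ 3) by field; rewrite gt_eqF.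
rewrite ler_pM2l ?mulr_gt0// -mulrDl ler_pM2r ?exprn_gt0 ?invr_gt0//.
nra.
Qed.

End Barrier.

(** * Minima of semicontinuous functions, and the growth condition *)

Lemma lsc_attains_min (R : realType) (T : topologicalType) (f : T -> R) (K : set T) :
  compact K -> K !=set0 ->
  (forall x c, K x -> c < f x -> \forall y \near x, K y -> c < f y) ->
  exists2 x, K x & forall y, K y -> f x <= f y.
Proof.
move=> cK [k Kk] lsc.
(* The sublevel sets of [f] in [K] form a filter base. At a cluster point [p], a value [f y < f p]
   would by semicontinuity give a neighbourhood of [p] missing the sublevel set of [y]. *)
pose F := filter_from K (fun y => [set x | K x /\ f x <= f y]).
have FF : ProperFilter F.
  apply: filter_from_proper; last by move=> y Ky; exists y.
  apply: filter_from_filter; first by exists k.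
  move=> i j Ki Kj; have [ij|ji] := leP (f i) (f j).
    by exists i => // x [Kx xi]; split; split => //; exact: le_trans xi ij.
  by exists j => // x [Kx xj]; split; split => //; exact: le_trans xj (ltW ji).
have [|p [Kp clp]] := cK F FF; first by exists k => // x [].
exists p => // y Ky; rewrite leNgt; apply/negP => fyp.
have [||x [[Kx xy] H]] := clp [set x | K x /\ f x <= f y] [set x | K x -> f y < f x].
- by exists y.
- exact: lsc.
by have := H Kx; rewrite ltNge xy.
Qed.

(** The condition gives [v >= - eta * (- ln d)] near the boundary, and
    [- ln d = ln (1 / d) <= 1 / d]. This weaker form is directly comparable with the barrier. *)
Lemma growth_lower_bound (R : realType) (n : nat) (Omega : set 'rV[R]_n)
    (v : 'rV[R]_n -> R) (eta : R) :
  0 < eta -> (forall x, Omega x -> 0 < sdist Omega x) ->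
  (0 <= limf_einf (fun x => (v x / (- ln (sdist Omega x)))%:E) (to_bdry Omega))%E ->
  exists2 r : R, 0 < r & forall x, collar Omega r x -> - (eta / sdist Omega x) <= v x.
Proof.
move=> eta0 d0; rewrite limf_einfE => vg.
have : ((- eta)%:E < ereal_sup
    [set ereal_inf [set (v x / - ln (sdist Omega x))%:E | x in V]
    | V in to_bdry Omega])%E.
  by apply: lt_le_trans vg; rewrite lte_fin oppr_lt0.
move=> /ereal_sup_gt[_ [V [r /= r0 rV] <-] etaV].
(* The cap at 1 makes [- ln d] positive, so that the quotient can be cleared. *)
exists (Num.min r 1); first by rewrite lt_min r0 ltr01.
move=> x [Ox]; rewrite lt_min => /andP[xr x1].
have dx := d0 _ Ox.
have : ((- eta)%:E < (v x / - ln (sdist Omega x))%:E)%E.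
  by apply: lt_le_trans etaV _; apply: ereal_inf_lbound; exists x => //; exact: rV.
have l0 : 0 < - ln (sdist Omega x) by rewrite oppr_gt0 ln_lt0// dx x1.
rewrite lte_fin ltr_pdivlMr// => H; apply: le_trans (ltW H).
rewrite mulNr lerN2 ler_pM2l//.
rewrite -lnV ?posrE//; apply/ltW/ln_sublinear; by rewrite invr_gt0.
Qed.

(** By cyclicity the trace is that of [q *m q^T] with [q = sg^T *m p^T]. *)
Lemma mxtrace_normal (R : realType) (n r : nat) (sg : 'M[R]_(n, r)) (p : 'rV[R]_n) :
  \tr ((sg *m sg^T) *m (p^T *m p)) = enorm (sg^T *m p^T) ^+ 2.
Proof.
rewrite -mulmxA [sg^T *m _]mulmxA mxtrace_mulC.
rewrite -(mulmxA (sg^T *m p^T)).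
set q := sg^T *m p^T; have -> : p *m sg = q^T by rewrite trmx_mul !trmxK.
rewrite enorm_sqr /mxtrace; apply: eq_bigr => i _; rewrite mxE.
by apply: eq_bigr => j _; rewrite [q^T _ _]mxE expr2.
Qed.

(** * The barrier as a strict test function near the boundary *)

Section BarrierTest.
Context {R : realType} {n : nat}.
Variables (Omega U : set 'rV[R]_n) (delta s c eps : R).
Hypotheses (Omega_open : open Omega) (OmegaC0 : ~` Omega !=set0).
Hypotheses (cU : closure (collar Omega delta) `<=` U) (dC2 : C2_on U (sdist Omega)).

Let h t : R := c - eps * barrier s t.
Let h1 t : R := - (eps * barrier1 s t).
Let h2 t : R := - (eps * barrier2 s t).

Let dh (t : R) : 0 < t -> is_derive t 1 h (h1 t).
Proof.
move=> t0; have db := is_derive_barrier s _ t0.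
apply: (is_derive_eq (f := cst c - eps \*: barrier s)).
by rewrite sub0r.
Qed.

Let dh1 (t : R) : 0 < t -> is_derive t 1 h1 (h2 t).
Proof.
move=> t0; have db := is_derive_barrier1 s _ t0.
exact: (is_derive_eq (f := - (eps \*: barrier1 s))).
Qed.

Let collar_C2 : C2_on (collar Omega delta) (sdist Omega).
Proof.
have [C0 C1 C2] := dC2.
have sub x : collar Omega delta x -> U x by move=> ?; exact/cU/subset_closure.
by split=> x /sub; [exact: C0|exact: C1|exact: C2].
Qed.

Let collar_pos x : collar Omega delta x -> 0 < sdist Omega x.
Proof. by move=> [Ox _]; exact: sdist_gt0. Qed.

(** Two open sets cover [Omega] because [s < delta]: the collar, where the distance is C^2, and the
    region where the distance exceeds [s] and the function is the constant [c]. *)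
Lemma C2_on_barrier : s < delta ->
  C2_on Omega (fun y => c - eps * barrier s (sdist Omega y)).
Proof.
move=> sd; rewrite -/(h \o sdist Omega).
have [C0 C1 C2] : C2_on (collar Omega delta) (h \o sdist Omega).
  apply: (@C2_on_comp _ _ _ [set t : R | 0 < t] _ _ h1 h2) => //.
  - exact: collar_open.
  - move=> t t0; apply: continuousN; apply: continuousM; first exact: cst_continuous.
    exact: barrier2_continuous.
pose V := [set x | s < sdist Omega x] `&` Omega.
have [D0 D1 D2] : C2_on V (h \o sdist Omega).
  apply: (@C2_on_eq _ _ V (cst c)).
  - apply: openI => //.
    apply: (@open_comp _ _ (sdist Omega) [set t | s < t]); last exact: open_gt.
    by move=> x _; exact: sdist_continuous.
  - move=> x [/= sx Ox]; rewrite /h barrier_eq0 ?mulr0 ?subr0//; last exact: ltW.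
    exact: sdist_gt0.
  - exact: C2_on_cst.
split=> x Ox; (have [xd|xd] := ltP (sdist Omega x) delta;
  [have Cx : collar Omega delta x by []|have Vx : V x by split => //=; exact: lt_le_trans sd xd]).
- exact: C0.
- exact: D0.
- exact: C1.
- exact: D1.
- exact: C2.
- exact: D2.
Qed.

Context {r : nat}.
Variables (b : 'rV[R]_n) (sigma : 'rV[R]_n -> 'M[R]_(n, r)).
Variables (B beta gamma k : R) (x : 'rV[R]_n).
Hypotheses (xc : collar Omega delta x) (xs : sdist Omega x <= s / 2).
Hypothesis eps0 : 0 < eps.
Hypothesis sigma_bdry : forall y, bdry Omega y ->
  (sigma y)^T *m (grad (sdist Omega) y)^T = 0.
Hypothesis sigma_Holder : forall y, bdry Omega y ->
  enorm (sigma x - sigma y) <= B * enorm (x - y) `^ beta.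
Hypothesis drift : k * sdist Omega x `^ gamma <=
  dot b (grad (sdist Omega) x)
  + \tr ((sigma x *m (sigma x)^T) *m hess (sdist Omega) x).
Hypothesis small : 12 * B ^+ 2 * sdist Omega x `^ (2 * beta - 1 - gamma) <= k.

Lemma diffusion_normal_le :
  \tr ((sigma x *m (sigma x)^T) *m ((grad (sdist Omega) x)^T *m grad (sdist Omega) x))
  <= B ^+ 2 * sdist Omega x `^ (2 * beta).
Proof.
set p := grad (sdist Omega) x.
(* [gy] carries the degeneracy of [sigma y] over to the gradient at [x], [xy] turns the Holder bound
   into a power of the distance, and [p1] normalizes the gradient. *)
have [y [yb xy gy p1]] := grad_sdist_nearest _ Omega_open OmegaC0 _ _ _ cU dC2 xc.
have stau := sigma_Holder _ yb; have taup := sigma_bdry _ yb.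
rewrite xy in stau; rewrite gy -/p in taup.
rewrite -/p in p1.
rewrite mxtrace_normal.
have -> : (sigma x)^T *m p^T = (sigma x - sigma y)^T *m p^T.
  by rewrite linearB /= mulmxBl taup subr0.
apply: le_trans (enorm_mulmx_sqr _ _ _ _ _) _.
rewrite !enorm_tr p1 expr1n mulr1.
rewrite (_ : B ^+ 2 * _ = (B * sdist Omega x `^ beta) ^+ 2); last first.
  by rewrite exprMn -(powR_mulrn 2 (powR_ge0 _ _)) -powRrM [beta * _]mulrC.
by rewrite ler_pXn2r// nnegrE ?enorm_ge0// (le_trans (enorm_ge0 _ _ _) stau).
Qed.

(** Half of the drift absorbs the second-order term: the factor 6 of [barrier2_le], doubled, is the
    12 in [small]. The other half remains as a negative bound free of [b] and [sigma], hence uniform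
    over controls. *)
Lemma linear_op_barrier_le :
  - dot b (grad (fun y => c - eps * barrier s (sdist Omega y)) x)
  - \tr ((sigma x *m (sigma x)^T) *m hess (fun y => c - eps * barrier s (sdist Omega y)) x)
  <= eps * barrier1 s (sdist Omega x) * (k / 2 * sdist Omega x `^ gamma).
Proof.
rewrite -/(h \o sdist Omega).
have cp y : collar Omega delta y -> [set t : R | 0 < t] (sdist Omega y) by exact: collar_pos.
rewrite (grad_comp _ _ _ _ _ (collar_open _ Omega_open delta) collar_C2 cp dh _ xc).
rewrite (hess_comp _ _ _ _ _ _ (collar_open _ Omega_open delta) collar_C2 cp dh dh1 _ xc).
have d0 := collar_pos _ xc.
have nd := diffusion_normal_le; have dr := drift; have sm := small; have xs' := xs.
rewrite dotZr mulmxDr -!scalemxAr mxtraceD !mxtraceZ.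
set Y := \tr (_ *m (_ *m _)) in nd *; set Z := \tr _ in dr *.
set d := sdist Omega x in d0 xs' nd dr sm *.
set X := dot _ _ in dr *.
have b1 := barrier1_lt0 _ _ d0 xs'; have b2 := barrier2_le _ _ d0 xs'.
have Y0 : 0 <= Y by rewrite /Y mxtrace_normal sqr_ge0.
rewrite /h1 /h2.
have g0 : 0 < d `^ gamma by exact: powR_gt0.
(* One power of [d] cancels against [6 / d]; the last factor is the one controlled by [small]. *)
have E : d `^ (2 * beta) = d * (d `^ gamma * d `^ (2 * beta - 1 - gamma)).
  rewrite -{2}(powRr1 (ltW d0)) -!powRD ?(gt_eqF d0) ?implybT//.
  by congr (_ `^ _); ring.
have Y6 : 6 / d * Y <= k / 2 * d `^ gamma.
  rewrite mulrAC ler_pdivrMr//.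
  apply: (@le_trans _ _ (6 * (B ^+ 2 * d `^ (2 * beta)))); first by rewrite ler_pM2l.
  rewrite E; move: sm; rewrite -(ler_pM2l (mulr_gt0 d0 g0)) => sm'; nra.
have b2Y : barrier2 s d * Y <= (- barrier1 s d) * (k / 2 * d `^ gamma).
  apply: (@le_trans _ _ (- 6 / d * barrier1 s d * Y)); first by rewrite ler_wpM2r.
  have -> : - 6 / d * barrier1 s d * Y = - barrier1 s d * (6 / d * Y) by ring.
  by rewrite ler_pM2l// oppr_gt0.
have XZ : barrier1 s d * (X + Z) <= barrier1 s d * (k * d `^ gamma) by rewrite ler_nM2l.
have -> : - (- (eps * barrier1 s d) * X) - (- (eps * barrier2 s d) * Y + - (eps * barrier1 s d) * Z)
  = eps * (barrier1 s d * (X + Z) + barrier2 s d * Y) by ring.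
by rewrite -mulrA ler_pM2l//; lra.
Qed.

End BarrierTest.

(** * Viscosity notions on an open set and passage to [- v] *)

Lemma C2_onN (R : realType) (n : nat) (U : set 'rV[R]_n) (f : 'rV[R]_n -> R) :
  open U -> C2_on U f -> C2_on U (fun x => - f x).
Proof.
move=> oU fC2; apply: (@C2_on_comp _ _ U setT f -%R (cst (-1)) (cst 0)) => //.
by move=> t _; exact: cst_continuous.
Qed.

(** Since [Omega] is open, subspace neighbourhoods of its points are ordinary neighbourhoods. *)
Lemma lsc_on_near (R : realType) (n : nat) (Omega : set 'rV[R]_n)
    (v : 'rV[R]_n -> R) x (c : R) :
  open Omega -> lsc_on Omega v -> Omega x -> c < v x -> \forall y \near x, c < v y.
Proof.
move=> oO vl Ox cv; have := vl x c; rewrite lte_fin => /(_ cv)[V nV Vc].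
have Ox' : interior Omega x by apply: open_nbhs_nbhs.
rewrite -(nbhs_subspace_interior Ox') in nV.
by apply: filterS nV => y /Vc; rewrite lte_fin.
Qed.

(** The maximum principle is applied to [- v]: a test function [phi] above [- v] yields [- phi]
    below [v]. *)
Lemma strong_min_principle_min (R : realType) (n : nat) (Omega : set 'rV[R]_n)
    (G : operator) (v : 'rV[R]_n -> R) :
  open Omega -> strong_min_principle Omega G -> lsc_on Omega v ->
  visc_supersol Omega G v ->
  (exists2 x0, Omega x0 & forall x, Omega x -> v x0 <= v x) ->
  constant_on Omega v.
Proof.
move=> oO smp vl vs [x0 Ox0 vmin].
have [| | |c vc] := smp (fun x => - v x).
- by rewrite /usc_on; under eq_fun do rewrite opprK.
- move=> phi x pC2 Ox px pv; rewrite oppe_le0.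
  have pv' : \forall y \near x, - phi y <= v y by apply: filterS pv => y; rewrite lerNl.
  exact: (vs (fun y => - phi y) x (C2_onN _ _ _ _ oO pC2) Ox (esym (canRL opprK (esym px))) pv').
- by exists x0 => // x Ox; rewrite lerN2; exact: vmin.
by exists (- c) => x Ox; rewrite -(vc x Ox) opprK.
Qed.

Lemma powR_small (R : realType) (p c : R) : 0 < p -> 0 < c ->
  exists2 r : R, 0 < r & forall t, 0 <= t <= r -> t `^ p <= c.
Proof.
move=> p0 c0; exists (c `^ p^-1); first exact: powR_gt0.
move=> t /andP[t0 tc].
have -> : c = (c `^ p^-1) `^ p by rewrite -powRrM mulVf ?gt_eqF// powRr1// ltW.
by apply: ge0_ler_powR; rewrite ?nnegrE ?powR_ge0// ltW.
Qed.

(** * Comparison with the barrier for an abstract operator [G] *)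

Section BarrierComparison.
Context {R : realType} {n : nat}.
Variables (Omega : set 'rV[R]_n) (G : @operator R n) (v : 'rV[R]_n -> R) (s d0 : R).
Hypotheses (Omega_open : open Omega) (Omega_bounded : bounded_set Omega).
Hypotheses (OmegaC0 : ~` Omega !=set0).
Hypotheses (v_lsc : lsc_on Omega v) (v_supersol : visc_supersol Omega G v).
Hypothesis v_growth :
  (0%E <= limf_einf (fun x => (v x / (- ln (sdist Omega x)))%:E) (to_bdry Omega))%E.
Hypotheses (s0 : 0 < s) (d00 : 0 < d0) (d0s : d0 <= s / 2).
Hypothesis barrier_C2 : forall c eps,
  C2_on Omega (fun y => c - eps * barrier s (sdist Omega y)).
Hypothesis barrier_sub : forall (c eps : R) x, 0 < eps -> Omega x -> sdist Omega x < d0 ->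
  (G (fun y => (c - eps * barrier s (sdist Omega y))%R) x < 0)%E.

Let superlevel_compact (t : R) : 0 < t -> compact [set x | t <= sdist Omega x].
Proof.
move=> t0; apply: bounded_closed_compact.
  have [M [Mr OM]] := Omega_bounded; exists M; split => // N MN x /= tx.
  by apply: OM => //; apply: sdist_gt0_in; exact: lt_le_trans tx.
apply: (@closed_comp _ _ (sdist Omega) [set u | t <= u]); last exact: closed_ge.
by move=> x _; exact: sdist_continuous.
Qed.

Lemma supersol_attains_min x0 : d0 <= sdist Omega x0 ->
  exists2 xm, Omega xm & forall x, Omega x -> v xm <= v x.
Proof.
move=> dx0.
have Oin x t : 0 < t -> t <= sdist Omega x -> Omega x.
  by move=> t0 tx; apply: sdist_gt0_in; exact: lt_le_trans tx.
have [||x c /= Kx cv|xm Kxm vmin] := @lsc_attains_min _ _ v [set x | d0 <= sdist Omega x].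
- exact: superlevel_compact.
- by exists x0.
- have := lsc_on_near _ _ _ _ _ _ Omega_open v_lsc (Oin _ _ d00 Kx) cv.
  by apply: filterS.
exists xm; first exact: Oin Kxm.
move=> x1 Ox1; rewrite leNgt; apply/negP => v1.
have d1 := sdist_gt0 _ Omega_open OmegaC0 _ Ox1.
have x1d0 : sdist Omega x1 < d0.
  by rewrite ltNge; apply/negP => /(vmin x1); rewrite leNgt v1.
set m := v xm in v1 vmin.
set c0 := barrier s d0; set b1 := barrier s (sdist Omega x1).
have b1c0 : c0 <= b1 by apply: barrier_nincr => //; exact: ltW.
(* This smallness means [g x1 < m] for the perturbed function [g] below. The summand 1 keeps the
   denominator positive even if [b1 = c0]. *)
have [eps eps0 epsb] : exists2 eps, 0 < eps & eps * (b1 - c0) < m - v x1.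
  have den0 : 0 < 2 * (b1 - c0 + 1) by lra.
  exists ((m - v x1) / (2 * (b1 - c0 + 1))); first by rewrite divr_gt0// subr_gt0.
  by rewrite mulrAC ltr_pdivrMr// ltr_pM2l ?subr_gt0//; lra.
pose g x := v x + eps * (barrier s (sdist Omega x) - c0).
have c00 : 0 <= c0.
  by rewrite exprn_ge0// le_max lexx.
(* The slope [eps * s / 4] is half of the [eps * s / 2] supplied by [barrier_ge], so [g + eps * c0]
   stays above [eps * s / (4 d)]; [r2] makes this exceed [|m| + eps * c0 + 1]. *)
have [r r0 vr] := growth_lower_bound _ _ _ v (eps * s / 4)
  (divr_gt0 (mulr_gt0 eps0 s0) (ltr0Sn _ _)) (sdist_gt0 _ Omega_open OmegaC0) v_growth.
pose r2 := eps * s / (4 * (`|m| + eps * c0 + 1)).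
have den2 : 0 < `|m| + eps * c0 + 1.
  by rewrite ltr_wpDl// addr_ge0// mulr_ge0// ltW.
have r20 : 0 < r2 by apply: divr_gt0; apply: mulr_gt0.
(* Including [sdist Omega x1] keeps [x1] in the compact set [K]. *)
pose r3 := Num.min (sdist Omega x1) (Num.min r r2).
have r30 : 0 < r3 by rewrite !lt_min d1 r0 r20.
have g_near x : Omega x -> sdist Omega x < r3 -> m <= g x.
  move=> Ox; rewrite !lt_min => /and3P[xx1 xr xr2].
  have dx := sdist_gt0 _ Omega_open OmegaC0 _ Ox.
  have vx := vr _ (conj Ox xr).
  have xs : sdist Omega x <= s / 2.
    by apply: le_trans d0s; apply/ltW/(lt_trans xx1).
  have bx := barrier_ge _ _ dx xs.
  rewrite /g; set d := sdist Omega x in xx1 xr xr2 dx vx xs bx *; clearbody d.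
  have : `|m| + eps * c0 + 1 <= eps * s / (4 * d).
    move: xr2; rewrite /r2 ltr_pdivlMr ?mulr_gt0// => xr2.
    by rewrite ler_pdivlMr ?mulr_gt0//; lra.
  have E1 : eps * (s / (2 * d)) = 2 * (eps * s / (4 * d)).
    by field; rewrite gt_eqF.
  have E2 : eps * s / 4 / d = eps * s / (4 * d).
    by field; rewrite gt_eqF.
  have := ler_wpM2l (ltW eps0) bx; rewrite E1 mulrBr.
  by rewrite E2 in vx; have := ler_norm m; lra.
have w_cont x : Omega x -> {for x, continuous (fun y => 0 - eps * barrier s (sdist Omega y))}.
  by move=> Ox; have [C0 _ _] := barrier_C2 0 eps; exact/differentiable_continuous/C0.
pose K := [set x | r3 <= sdist Omega x] `&` [set x | sdist Omega x <= d0].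
have x1K : K x1 by split => /=; [rewrite ge_min lexx|exact: ltW].
have [||x c [/= Kx _] cg|x2 [/= r3x2 x2d0] gmin] := @lsc_attains_min _ _ g K.
- apply: compact_closedI; first exact: superlevel_compact.
  apply: (@closed_comp _ _ (sdist Omega) [set u | u <= d0]); last exact: closed_le.
  by move=> x _; exact: sdist_continuous.
- by exists x1.
- have Ox := Oin _ _ r30 Kx.
  pose e := (g x - c) / 2; have e0 : 0 < e by rewrite divr_gt0// subr_gt0.
  have nv : \forall y \near x, v x - e < v y.
    by apply: (lsc_on_near _ _ _ _ _ _ Omega_open v_lsc Ox); rewrite gtrBl.
  have := w_cont _ Ox; rewrite /prop_for /continuous_at => /cvgrPdist_lt /(_ _ e0) nw.
  near=> y => _.
  have H1 : v x - e < v y by near: y.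
  have : `|(0 - eps * barrier s (sdist Omega x)) - (0 - eps * barrier s (sdist Omega y))| < e.
    by near: y.
  rewrite ltr_norml => /andP[H2 H3].
  by rewrite /e /g in H1 H2 H3 *; lra.
have gx2 : g x2 < m.
  by apply: (@le_lt_trans _ _ (g x1)); [exact: gmin|rewrite /g -/b1; lra].
have Ox2 := Oin _ _ r30 r3x2.
(* At distance exactly [d0] the perturbation vanishes, so [g = v >= m] there. *)
have x2d : sdist Omega x2 < d0.
  rewrite lt_neqAle x2d0 andbT; apply/negP => /eqP E.
  have : m <= v x2 by apply: vmin; rewrite /= E.
  by move: gx2; rewrite /g E subrr mulr0 addr0 ltNge => /negP.
(* The constant gives [phi x2 = v x2], and [phi y <= v y] is the same as [g x2 <= g y]. *)
pose phi y := (g x2 + eps * c0) - eps * barrier s (sdist Omega y).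
have := barrier_sub (g x2 + eps * c0) eps x2 eps0 Ox2 x2d.
rewrite ltNge => /negP; apply; apply: v_supersol => //.
  by rewrite /g; ring.
have nO : \forall y \near x2, Omega y by apply: open_nbhs_nbhs.
have nd : \forall y \near x2, sdist Omega y < d0.
  by have := sdist_continuous Omega x2; move=> /(_ _ (lt_nbhsl x2d)).
near=> y.
have Oy : Omega y by near: y.
have yd : sdist Omega y < d0 by near: y.
(* Near [x2] a point lies either in [K], where [x2] is minimal, or at distance below [r3], where
   [g >= m > g x2]. *)
have : g x2 <= g y.
  have [r3y|yr3] := leP r3 (sdist Omega y).
    by apply: gmin; split => //=; exact: ltW.
  by apply: le_trans (ltW gx2) _; exact: g_near.
by rewrite {2}/g; lra.
Unshelve. all: by end_near. Qed.

End BarrierComparison.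

Theorem theorem4p2 (R : realType) (n m r : nat) (hn : (0 < n)%N) (hr : (0 < r)%N)
  (Omega : set 'rV[R]_n) (A : set 'rV[R]_m)
  (b : 'rV[R]_n -> 'rV[R]_m -> 'rV[R]_n)
  (a : 'rV[R]_n -> 'rV[R]_m -> 'M[R]_n)
  (sigma : 'rV[R]_n -> 'rV[R]_m -> 'M[R]_(n, r))
  (Omega_bounded : bounded_set Omega)
  (Omega_connected : connected Omega)
  (Omega_open : open Omega)
  (Omega_C2 : C2_boundary Omega)
  (A_closed : closed A)
  (b_bounded : exists M : R, forall x alpha,
     closure Omega x -> A alpha -> enorm (b x alpha) <= M)
  (b_continuous : {within closure Omega `*` A, continuous (fun p => b p.1 p.2)})
  (a_bounded : exists M : R, forall x alpha,
     closure Omega x -> A alpha -> enorm (a x alpha) <= M)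
  (a_continuous : {within closure Omega `*` A, continuous (fun p => a p.1 p.2)})
  (a_sym : forall x alpha, closure Omega x -> A alpha ->
     (a x alpha)^T = a x alpha)
  (a_nonneg : forall x alpha, closure Omega x -> A alpha ->
     forall xi : 'rV[R]_n, 0 <= dot (xi *m a x alpha) xi)
  (a_sigma : forall x alpha, closure Omega x -> A alpha ->
     a x alpha = sigma x alpha *m (sigma x alpha)^T)
  (omega : R -> R) (omega_modulus : modulus_of_continuity omega)
  (b_modulus : forall x y alpha,
     closure Omega x -> closure Omega y -> A alpha ->
     enorm (b x alpha - b y alpha) <= omega (enorm (x - y)))
  (beta B : R) (beta_gt : 2^-1 < beta) (beta_le : beta <= 1) (B_gt0 : 0 < B)
  (sigma_Holder : forall x y alpha,
     closure Omega x -> closure Omega y -> A alpha ->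
     enorm (sigma x alpha - sigma y alpha) <= B * enorm (x - y) `^ beta)
  (delta k gamma : R) (delta_gt0 : 0 < delta) (k_gt0 : 0 < k)
  (gamma_lt : gamma < 2 * beta - 1)
  (sdist_C2 : exists U : set 'rV[R]_n,
     [/\ open U, closure (collar Omega delta) `<=` U & C2_on U (sdist Omega)])
  (sigma_bdry : forall x alpha, bdry Omega x -> A alpha ->
     (sigma x alpha)^T *m (grad (sdist Omega) x)^T = 0)
  (drift_bdry : forall x alpha, collar Omega delta x -> A alpha ->
     k * sdist Omega x `^ gamma <=
       dot (b x alpha) (grad (sdist Omega) x)
       + \tr (a x alpha *m hess (sdist Omega) x))
  (F_smp : strong_min_principle Omega (HJB A b a))
  (v : 'rV[R]_n -> R) (v_lsc : lsc_on Omega v)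
  (v_supersol : visc_supersol Omega (HJB A b a) v)
  (v_growth :
     (0%E <= limf_einf (fun x => (v x / (- ln (sdist Omega x)))%:E)
              (to_bdry Omega))%E) :
  constant_on Omega v.
Proof.
have OmegaC0 := bounded_setC_nonempty Omega hn Omega_bounded.
have [->|/set0P[x0 Ox0]] := eqVneq Omega set0; first by exists 0.
have [U [_ cU dC2]] := sdist_C2.
pose s := delta / 2.
have s0 : 0 < s by rewrite divr_gt0.
have sd : s < delta by rewrite /s; lra.
have p0 : 0 < 2 * beta - 1 - gamma by lra.
have c0 : 0 < k / (12 * B ^+ 2) by rewrite divr_gt0// mulr_gt0// exprn_gt0.
have [r1 r10 r1P] := powR_small _ _ _ p0 c0.
(* The three bounds serve the barrier estimates, the absorption of the diffusion, and the presence
   of [x0] in the region at distance at least [d0]. *)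
pose d0 := Num.min (s / 2) (Num.min r1 (sdist Omega x0)).
have d00 : 0 < d0 by rewrite !lt_min divr_gt0//= r10/=; exact: sdist_gt0.
apply: (strong_min_principle_min _ _ _ _ _ Omega_open F_smp v_lsc v_supersol).
apply: (supersol_attains_min Omega (HJB A b a) v s d0) (x0) _ => //.
- by rewrite ge_min lexx.
- by move=> c eps; exact: (C2_on_barrier Omega U delta s c eps Omega_open OmegaC0 cU dC2 sd).
- move=> c eps x eps0 Ox; rewrite !lt_min => /and3P[xs xr _].
  have dx := sdist_gt0 _ Omega_open OmegaC0 _ Ox.
  have xc : collar Omega delta x by split => //; rewrite /s in xs; lra.
  have cO : closure Omega x by exact: subset_closure.
  have small : 12 * B ^+ 2 * sdist Omega x `^ (2 * beta - 1 - gamma) <= k.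
    rewrite mulrC -ler_pdivlMr ?mulr_gt0 ?exprn_gt0//; apply: r1P.
    by rewrite !ltW.
  (* The intermediate bound does not depend on [alpha], so strict negativity survives the
     supremum. *)
  apply: (@le_lt_trans _ _
    (eps * barrier1 s (sdist Omega x) * (k / 2 * sdist Omega x `^ gamma))%:E).
    apply: ge_ereal_sup => _ [alpha Aa <-]; rewrite lee_fin a_sigma//.
    apply: (@linear_op_barrier_le R n Omega U delta s c eps Omega_open OmegaC0 cU dC2 r
      (b x alpha) (sigma ^~ alpha) B beta gamma k x) => //.
    + exact: ltW.
    + by move=> y yb; exact: sigma_bdry.
    + by move=> y [cy _]; exact: sigma_Holder.
    + by rewrite -a_sigma//; exact: drift_bdry.
  rewrite lte_fin -mulrA pmulr_rlt0// nmulr_rlt0 ?mulr_gt0 ?divr_gt0 ?powR_gt0//.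
  by apply: barrier1_lt0 => //; exact: ltW.
- by rewrite !ge_min lexx !orbT.
Qed.
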